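(* Let $j$ and $k$ be positive integers. For real $\rho>0$ let the coefficients $B_l(\rho)$, $0\le l\le j+k$, be defined by the identity (in $s$, for $0\le s<\rho$) $$\int_0^{\sqrt{\rho^2-s^2}} z^{2j}\,(z^2+s^2)^k\,dz \;=\; \sqrt{\rho^2-s^2}\;\sum_{l=0}^{j+k} B_l(\rho)\, s^{2l}.$$ For each integer $m\ge 1$ let $$\mu_m(\rho)=\frac{2\,\Gamma(m+1/2)}{\sqrt{\pi}\,\Gamma(m+1)}\;{}_2F_1\!\left(1-m,\tfrac12;\tfrac12-m;\rho^2\right).$$ Then, for any positive integer $N$ with $j\le N\le k+j$, the quantity $$B_N(\rho)+\frac{1-\rho^2}{2}\sum_{m=1}^{j+k-N}\mu_m(\rho)\,B_{N+m}(\rho)$$ is independent of $\rho$; that is, for fixed $j,k,N$ it takes the same value for all real $\rho>0$.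
   Context: Here ${}_2F_1(a,b;c;x)=\sum_{n\ge 0}\frac{(a)_n (b)_n}{(c)_n\, n!}x^n$ is the Gauss hypergeometric function, with $(a)_n=a(a+1)\cdots(a+n-1)$ and $(a)_0=1$. For an integer $m\ge1$ the parameter $1-m$ is a nonpositive integer and $\tfrac12-m$ is not an integer, so the series terminates and $\mu_m(\rho)$ is a polynomial in $\rho^2$ of degree $m-1$, defined for every real $\rho$. The integral on the left-hand side of the defining identity equals $\sqrt{\rho^2-s^2}$ times a polynomial in $s^2$ of degree at most $j+k$, so the coefficients $B_l(\rho)$ exist and are uniquely determined. An empty sum (the case $N=j+k$) is zero. *)

(* Defs.v *)
From mathcomp Require Import all_boot all_order all_algebra.
From mathcomp Require Import all_classical all_reals all_analysis.
Set Implicit Arguments.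
Unset Strict Implicit.
Unset Printing Implicit Defensive.
Import Order.TTheory GRing.Theory Num.Theory.
Import numFieldNormedType.Exports.
Local Open Scope classical_set_scope.
Local Open Scope ring_scope.

Definition Gamma (R : realType) (x : R) : R :=
  \int[@lebesgue_measure R]_(t in `]0, +oo[) (t `^ (x - 1) * expR (- t)).

Definition poch (R : realType) (a : R) (n : nat) : R :=
  \prod_(i < n) (a + i%:R).

(* The value is meaningful when no (c)_n vanishes and the series converges;
   in particular when a is a nonpositive integer and c is not an integer, the
   series is a finite sum. *)
Definition hyp2F1 (R : realType) (a b c x : R) : R :=
  limn (series (fun n : nat =>
    poch a n * poch b n / (poch c n * n`!%:R) * x ^+ n)).

Definition mu (R : realType) (m : nat) (rho : R) : R :=
  2 * Gamma (m%:R + 2^-1) / (Num.sqrt pi * Gamma (m%:R + 1)) *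
  hyp2F1 (1 - m%:R) 2^-1 (2^-1 - m%:R) (rho ^+ 2).

(* B l rho stands for B_l(rho); this determines it for l <= j + k and rho > 0,
   and leaves all other values unconstrained. *)
Definition is_expansion (R : realType) (j k : nat) (B : nat -> R -> R) : Prop :=
  forall rho s : R, 0 < rho -> 0 <= s < rho ->
    \int[@lebesgue_measure R]_(z in `[0, Num.sqrt (rho ^+ 2 - s ^+ 2)])
      (z ^+ (2 * j) * (z ^+ 2 + s ^+ 2) ^+ k) =
    Num.sqrt (rho ^+ 2 - s ^+ 2) *
      \sum_(0 <= l < (j + k).+1) B l rho * s ^+ (2 * l).

(* Main.v *)
Require Import Defs.
From mathcomp Require Import all_boot all_order all_algebra.
From mathcomp Require Import all_classical all_reals all_analysis.
From mathcomp Require Import measurable_realfun.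
From mathcomp Require Import ring lra zify.

(** Put a_n = (1/2)_n / n!, the coefficients of the power series of
    1 / sqrt (1 - x), let n = j + k and r = rho ^ 2.

    Expanding (z ^ 2 + s ^ 2) ^ k and integrating shows that the B_l are the
    coefficients of the polynomial in u = s ^ 2
      P = sum_i 'C(k, i) / (2 (j + i) + 1) u ^ (k - i) (r - u) ^ (j + i),
    which is homogeneous of degree n in (r, u). Up to the factor r, the operator
    (r - u) (n - u d/du) multiplies the i-th term by j + i, so that it cancels
    the denominators and produces the differential equation
      2 (r - u) (n P - u P') + r P = r ^ (k + 1) (r - u) ^ j
    ([expansion_poly_ode]). The right-hand side has degree j in u; comparing
    the coefficients above degree j gives a two-term recurrence, the one of the
    a_m, whence B_(n-m) = a_m r ^ m B_n for m <= k
    ([coef_expansion_poly]). Moreover B_n does not depend on r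
    ([lead_expansion_poly]).

    On the other side mu_m = 2 sum_(i < m) a_i a_(m-i) (m - i) / m r ^ i
    ([muE]). This needs the values of Gamma at integers and half-integers,
    obtained from the functional equation ([eGamma_succ]) and the Gaussian
    integral ([eGamma_half]).

    With M = n - N <= k the quantity to study is B_n times
      a_M r ^ M + (1 - r) sum_(1 <= m <= M)
        (sum_(i < m) a_i a_(m-i) (m - i) / m r ^ i) a_(M-m) r ^ (M-m).
    In the double sum, the coefficient of r ^ (M - q) is
    q a_q sum_(q <= m <= M) a_(m-q) a_(M-m) / m, which is equal to a_M for every
    q by a partial fraction identity ([isqrt_coef_partial_fraction]). The sum
    over q is then geometric and everything collapses to the constant
    a_M B_n. *)

Import Order.TTheory GRing.Theory Num.Theory.
Import numFieldNormedType.Exports.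
Local Open Scope classical_set_scope.
Local Open Scope ring_scope.
Set Implicit Arguments.
Unset Strict Implicit.

(** * The coefficients of (1 - x)^(-1/2) *)

(** Also equal to 'C(2 n, n) / 4 ^ n. *)
Definition isqrt_coef (R : realType) (n : nat) : R := poch 2^-1 n / n`!%:R.

Lemma pochS (R : realType) (a : R) (n : nat) :
  poch a n.+1 = poch a n * (a + n%:R).
Proof. by rewrite /poch big_ord_recr. Qed.

Lemma isqrt_coef0 (R : realType) : isqrt_coef R 0 = 1.
Proof. by rewrite /isqrt_coef /poch big_ord0 fact0 divr1. Qed.

Lemma isqrt_coefS (R : realType) (n : nat) :
  n.+1%:R * isqrt_coef R n.+1 = (n%:R + 2^-1) * isqrt_coef R n.
Proof.
rewrite /isqrt_coef pochS factS natrM; field.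
by rewrite nat1r !pnatr_eq0 -lt0n fact_gt0.
Qed.

(** Coefficient form of the differential equation (1 - x) f' = f / 2 of
    f = (1 - x)^(-1/2), multiplied by an arbitrary power series g. *)
Lemma isqrt_coef_convS (R : realType) (n : nat) (g : nat -> R) :
  \sum_(i < n.+2) g i * ((n.+1 - i)%:R * isqrt_coef R (n.+1 - i)) =
  \sum_(i < n.+1) g i * ((n - i)%:R + 2^-1) * isqrt_coef R (n - i).
Proof.
rewrite big_ord_recr /= subnn mul0r mulr0 addr0.
apply: eq_bigr => i _; have ile : (i <= n)%N by rewrite -ltnS.
by rewrite subSn // isqrt_coefS mulrA.
Qed.

(** The square of (1 - x)^(-1/2) is 1 / (1 - x). By symmetry n + 1 times the
    convolution of order n + 1 is twice the sum of the a_i (n+1-i) a_(n+1-i),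
    and the recurrence turns it into n + 1 times the convolution of order n. *)
Lemma isqrt_coef_conv (R : realType) (n : nat) :
  \sum_(i < n.+1) isqrt_coef R i * isqrt_coef R (n - i) = 1.
Proof.
elim: n => [|n IHn]; first by rewrite big_ord1 subnn isqrt_coef0 mulr1.
have rev (m : nat) (F : nat -> nat -> R) :
    \sum_(i < m.+1) F i (m - i)%N = \sum_(i < m.+1) F (m - i)%N i.
  rewrite (reindex_inj rev_ord_inj) /=; apply: eq_bigr => i _.
  by rewrite subSS subKn // -ltnS.
apply: (mulfI (x := n.+1%:R)); first by rewrite pnatr_eq0.
rewrite mulr1 mulr_sumr.
transitivity (2 * \sum_(i < n.+2)
    isqrt_coef R i * ((n.+1 - i)%:R * isqrt_coef R (n.+1 - i))).
  rewrite mulr_natl mulr2n {2}(rev _ (fun i l => isqrt_coef R i * (l%:R * isqrt_coef R l))).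
  rewrite -big_split /=; apply: eq_bigr => i _.
  rewrite natrB; last by rewrite -ltnS.
  ring.
rewrite isqrt_coef_convS.
transitivity (\sum_(i < n.+1) n.+1%:R * (isqrt_coef R i * isqrt_coef R (n - i))); last first.
  by rewrite -mulr_sumr IHn mulr1.
rewrite mulr_natl mulr2n.
rewrite {2}(rev _ (fun i l => isqrt_coef R i * (l%:R + 2^-1) * isqrt_coef R l)).
rewrite -big_split /=; apply: eq_bigr => i _.
rewrite natrB; last by rewrite -ltnS.
by rewrite -natr1; field.
Qed.

(** This is sum_i a_i a_(n-i) / (x + i) = (x + 1/2)_n / (x)_(n+1), the
    partial fraction decomposition of the right-hand side, at x = q. Both sides
    satisfy the recurrence S_(n+1) (q+n+1) = S_n (q+n+1/2): in
    (q+n+1) / (q+i) = 1 + (n+1-i) / (q+i) the ones sum to the convolution of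
    order n + 1, and the recurrence of the a_l produces the convolution of
    order n with the opposite sign. *)
Lemma isqrt_coef_partial_fraction (R : realType) (q n : nat) : (0 < q)%N ->
  q%:R * isqrt_coef R q *
    \sum_(i < n.+1) isqrt_coef R i * isqrt_coef R (n - i) / (q + i)%:R =
  isqrt_coef R (q + n).
Proof.
move=> q0; elim: n => [|n IHn].
  rewrite big_ord1 subnn isqrt_coef0 !addn0; field.
  by rewrite pnatr_eq0 -lt0n.
apply: (mulfI (x := (q + n).+1%:R)); first by rewrite pnatr_eq0.
rewrite addnS isqrt_coefS -IHn.
rewrite mulrCA [RHS]mulrCA; congr (_ * _).
transitivity (1 + \sum_(i < n.+2)
   isqrt_coef R i / (q + i)%:R * ((n.+1 - i)%:R * isqrt_coef R (n.+1 - i))).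
  rewrite -[X in _ = X + _](isqrt_coef_conv R n.+1) mulr_sumr -big_split /=.
  apply: eq_bigr => i _.
  have -> : (q + n).+1%:R = (q + i)%:R + (n.+1 - i)%:R :> R.
    by rewrite -natrD; congr _%:R; have := ltn_ord i; lia.
  field; rewrite -natrD pnatr_eq0; lia.
have /= -> := isqrt_coef_convS n (fun i => isqrt_coef R i / (q + i)%:R).
rewrite -[X in X + _ = _](isqrt_coef_conv R n) mulr_sumr -big_split /=.
apply: eq_bigr => i _.
have -> : (q + n)%:R = (q + i)%:R + (n - i)%:R :> R.
  by rewrite -natrD; congr _%:R; have := ltn_ord i; lia.
field; rewrite -natrD pnatr_eq0; lia.
Qed.

(** Ordering the double sum by the exponent M - q of r, with q = m - i, makes
    every coefficient equal to a_M by the partial fraction identity; what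
    remains is a geometric sum. *)
Lemma mu_sum_collapse (R : realType) (r : R) (M : nat) :
  (1 - r) * \sum_(1 <= m < M.+1)
     (\sum_(i < m) isqrt_coef R i * isqrt_coef R (m - i) * (m - i)%:R / m%:R * r ^+ i) *
     (isqrt_coef R (M - m) * r ^+ (M - m)) = isqrt_coef R M * (1 - r ^+ M).
Proof.
have -> : \sum_(1 <= m < M.+1)
     (\sum_(i < m) isqrt_coef R i * isqrt_coef R (m - i) * (m - i)%:R / m%:R * r ^+ i) *
     (isqrt_coef R (M - m) * r ^+ (M - m)) =
   \sum_(1 <= q < M.+1) isqrt_coef R M * r ^+ (M - q).
  transitivity (\sum_(1 <= m < M.+1) \sum_(1 <= q < M.+1 | (q < m.+1)%N)
      q%:R * isqrt_coef R q * r ^+ (M - q) *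
      (isqrt_coef R (m - q) * isqrt_coef R (M - m) / m%:R)).
    apply: eq_big_nat => m /andP[m0 mM].
    rewrite -(big_mkord xpredT (fun i => isqrt_coef R i * isqrt_coef R (m - i) *
       (m - i)%:R / m%:R * r ^+ i)) big_nat_rev /= add0n mulr_suml.
    rewrite -(big_nat_widen 1 m.+1 M.+1 xpredT) //.
    rewrite [RHS]big_add1 /=; apply: eq_big_nat => i /andP[_ im].
    have -> : (M - i.+1 = (m - i.+1) + (M - m))%N by lia.
    rewrite subKn // exprD; ring.
  rewrite (exchange_big_dep_nat xpredT) //=.
  apply: eq_big_nat => q /andP[q0 qM].
  rewrite -mulr_sumr.
  have -> : \sum_(1 <= m < M.+1 | (q < m.+1)%N)
      isqrt_coef R (m - q) * isqrt_coef R (M - m) / m%:R =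
      \sum_(i < (M - q).+1) isqrt_coef R i * isqrt_coef R (M - q - i) / (q + i)%:R.
    rewrite -(big_mkord xpredT (fun i => isqrt_coef R i * isqrt_coef R (M - q - i) /
      (q + i)%:R)) -subSn //.
    rewrite -(big_nat_widenl q 1 M.+1 xpredT) // -{1}(add0n q) big_addn.
    apply: eq_big_nat => i /andP[_ iM].
    by rewrite addnK addnC subnDA.
  by rewrite mulrAC isqrt_coef_partial_fraction // subnKC.
rewrite -mulr_sumr mulrCA; congr (_ * _).
rewrite big_add1 /= big_nat_rev /= add0n.
under eq_big_nat => i /andP[_ iM] do rewrite subnSK // subKn ?(ltnW iM) //.
rewrite big_mkord.
by rewrite -[1 - r ^+ M]opprB subrX1 -mulNr opprB.
Qed.

(** * The polynomial of the expansion coefficients *)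

Lemma Rintegral_horner (R : realType) (p : {poly R}) (w : R) : 0 < w ->
  \int[@lebesgue_measure R]_(z in `[0, w]) (p^`()).[z] = p.[w] - p.[0].
Proof.
move=> w0; rewrite /Rintegral (continuous_FTC2 (F := horner p)) //.
- by apply: continuous_subspaceT => z; exact: continuous_horner.
- split.
  + by move=> z _; exact: derivable_horner.
  + by apply: cvg_at_right_filter; exact: continuous_horner.
  + by apply: cvg_at_left_filter; exact: continuous_horner.
- by move=> z _; rewrite derivE.
Qed.

(** Integrating the binomial expansion of z ^ 2j (z ^ 2 + u) ^ k from 0 to
    w = sqrt (r - u) term by term yields w times this polynomial, evaluated at
    u. *)
Definition expansion_poly (R : realType) (j k : nat) (r : R) : {poly R} :=
  \sum_(i < k.+1) ('C(k, i)%:R / (2 * (j + i) + 1)%:R) *: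
    ('X^(k - i) * (r%:P - 'X) ^+ (j + i)).

Lemma integral_expansion (R : realType) (j k : nat) (rho s : R) :
  0 <= s < rho ->
  \int[@lebesgue_measure R]_(z in `[0, Num.sqrt (rho ^+ 2 - s ^+ 2)])
      (z ^+ (2 * j) * (z ^+ 2 + s ^+ 2) ^+ k) =
  Num.sqrt (rho ^+ 2 - s ^+ 2) * (expansion_poly j k (rho ^+ 2)).[s ^+ 2].
Proof.
move=> /andP[s0 srho].
have r2 : 0 < rho ^+ 2 - s ^+ 2.
  by rewrite subr_gt0 ltr_pXn2r ?nnegrE // ltW // (le_lt_trans s0).
set w := Num.sqrt _.
have w0 : 0 < w by rewrite sqrtr_gt0.
have w2 : w ^+ 2 = rho ^+ 2 - s ^+ 2 by rewrite sqr_sqrtr // ltW.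
pose p : {poly R} := \sum_(i < k.+1)
   ('C(k, i)%:R / (2 * (j + i) + 1)%:R * (s ^+ 2) ^+ (k - i)) *: 'X^(2 * (j + i) + 1).
transitivity (\int[@lebesgue_measure R]_(z in `[0, w]) (p^`()).[z]).
  apply: eq_Rintegral => z _.
  rewrite addrC exprDn mulr_sumr /p raddf_sum horner_sum /=.
  apply: eq_bigr => i _.
  rewrite derivZ derivXn addn1 /= !hornerE.
  rewrite hornerMn hornerXn -(mulr_natl _ 'C(k, i)).
  rewrite -(mulr_natl _ (2 * (j + i)).+1).
  have : (2 * (j + i)).+1%:R != 0 :> R by rewrite pnatr_eq0.
  set d := _.+1%:R => d0; rewrite mulnDr exprD -(exprM z 2 i).
  by field.
rewrite Rintegral_horner // /p !horner_sum /expansion_poly.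
rewrite [X in _ - X]big1 ?subr0; last first.
  by move=> i _; rewrite !hornerE addn1 expr0n mulr0.
rewrite mulr_sumr; apply: eq_bigr => i _.
rewrite !hornerE /= -w2 addn1 (exprS w (2 * (j + i))) (exprM w 2 (j + i)); ring.
Qed.

(** The identity defining the B_l holds for all s in [0, rho), hence at
    infinitely many values of s ^ 2, so that it is an identity of
    polynomials. *)
Lemma B_eq_coef (R : realType) (j k : nat) (B : nat -> R -> R) :
  is_expansion j k B -> forall (rho : R) (l : nat), 0 < rho -> (l <= j + k)%N ->
  B l rho = (expansion_poly j k (rho ^+ 2))`_l.
Proof.
move=> hB rho l rho0 ljk.
pose q : {poly R} := \poly_(i < (j + k).+1) B i rho.
suff <- : q = expansion_poly j k (rho ^+ 2) by rewrite coef_poly ltnS ljk.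
have agree (s : R) : 0 <= s < rho ->
    q.[s ^+ 2] = (expansion_poly j k (rho ^+ 2)).[s ^+ 2].
  move=> sr; have := hB rho s rho0 sr; rewrite integral_expansion //.
  have r2 : 0 < rho ^+ 2 - s ^+ 2.
    case/andP: sr => s0 sr.
    by rewrite subr_gt0 ltr_pXn2r ?nnegrE // ltW.
  move/(mulfI (lt0r_neq0 _)) => -> //; last by rewrite sqrtr_gt0.
  rewrite horner_poly big_mkord; apply: eq_bigr => i _.
  by rewrite exprM.
apply/eqP; rewrite -subr_eq0; set d := q - _.
have [//|d0] := eqVneq d 0.
(* The shift by 2 keeps every sample point rho / (i + 2) strictly below rho. *)
pose f (i : nat) : R := (rho / i.+2%:R) ^+ 2.
have fpos (i : nat) : 0 <= rho / i.+2%:R < rho.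
  by rewrite divr_ge0 ?(ltW rho0) //= ltr_pdivrMr ?ltr_pMr ?ltr1n.
have : (size (mkseq f (size d)) < size d)%N.
  apply: max_poly_roots d0 _ _.
    apply/allP => _ /mapP[i _ ->]; rewrite /root /d hornerD hornerN agree //.
    by rewrite subrr.
  rewrite map_inj_uniq ?iota_uniq // => a b /eqP.
  have nn (i : nat) : 0 <= rho / i.+2%:R by have /andP[] := fpos i.
  rewrite /f eqrXn2 ?nn // => /eqP/(mulfI (lt0r_neq0 rho0))/invr_inj/eqP.
  by rewrite eqr_nat => /eqP[].
by rewrite size_mkseq ltnn.
Qed.

(** Euler homogeneity: n - X d/dX is r d/dr on forms of degree n = a + b in
    (r, X), and r d/dr only sees the factor (r - X) ^ b, out of which it brings
    r b / (r - X); hence the multiplication by r - X. *)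
Lemma subCX_term_euler (R : realType) (r : R) (a b : nat) :
  let p : {poly R} := 'X^a * (r%:P - 'X) ^+ b in
  (r%:P - 'X) * ((a + b)%:R *: p - 'X * p^`()) = (r * b%:R) *: p.
Proof.
have XD c : 'X * ('X^c)^`() = c%:R *: 'X^c :> {poly R}.
  by rewrite derivXn; case: c => [|c]; rewrite ?mulr0n ?mulr0 ?scale0r //=
    mulrnAr -exprS scaler_nat.
have YD c : (r%:P - 'X) * ((r%:P - 'X) ^+ c)^`() =
    - (c%:R *: (r%:P - 'X) ^+ c) :> {poly R}.
  rewrite deriv_exp derivB derivC derivX sub0r.
  case: c => [|c] /=; first by rewrite mulr0n mulr0 scale0r oppr0.
  by rewrite mulrnAr mulN1r mulrN -exprS mulNrn scaler_nat.
move=> p; rewrite /p derivM.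
set Y := r%:P - 'X in YD *; set U := 'X^a; set V := Y ^+ b.
have -> : 'X * (U^`() * V + U * V^`()) = a%:R *: (U * V) + 'X * U * V^`().
  by rewrite mulrDr !mulrA XD -scalerAl.
rewrite mulrBr mulrDr !mulrA.
have -> : Y * 'X * U * V^`() = - (b%:R *: ('X * U * V)).
  by rewrite -[Y * 'X]mulrC -!mulrA [Y * _]mulrCA YD !mulrN -!scalerAr.
rewrite -!mul_polyC polyCM /Y natrD polyCD.
ring.
Qed.

(** The operator multiplies the i-th term of the polynomial by
    r (2 (j + i) + 1), which cancels its denominator; the binomial theorem for
    (X + (r - X)) ^ k = r ^ k then sums the result. *)
Lemma expansion_poly_ode (R : realType) (j k : nat) (r : R) :
  let P := expansion_poly j k r in
  2 *: ((r%:P - 'X) * ((j + k)%:R *: P - 'X * P^`())) + r *: P =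
  r ^+ k.+1 *: (r%:P - 'X) ^+ j.
Proof.
move=> P; rewrite /P /expansion_poly [(\sum_(i < k.+1) _)^`()]raddf_sum.
set Y : {poly R} := r%:P - 'X.
have -> : r ^+ k.+1 *: Y ^+ j =
    \sum_(i < k.+1) (r * 'C(k, i)%:R) *: ('X^(k - i) * Y ^+ (j + i)).
  have {1}-> : r ^+ k.+1 *: Y ^+ j = r *: (Y ^+ j * ('X + Y) ^+ k).
    by rewrite addrC subrK exprS -scalerA -polyC_exp mulrC mul_polyC.
  rewrite (exprDn 'X Y) mulr_sumr scaler_sumr; apply: eq_bigr => i _.
  by rewrite exprD -scalerA scaler_nat mulrnAr mulrCA.
rewrite scaler_sumr mulr_sumr -sumrB mulr_sumr scaler_sumr scaler_sumr -big_split /=.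
apply: eq_bigr => i _.
have e : (j + k = (k - i) + (j + i))%N by have := ltn_ord i; lia.
have := subCX_term_euler r (k - i) (j + i); rewrite -/Y /=.
set p := 'X^(k - i) * _ => hp.
set c := _ / _.
have -> : (j + k)%:R *: (c *: p) - 'X * (c *: p)^`() =
    c *: ((j + k)%:R *: p - 'X * p^`()).
  by rewrite derivZ -scalerAr scalerBr !scalerA (mulrC c).
rewrite -scalerAr e hp !scalerA -scalerDl; congr (_ *: _).
rewrite /c natrD natrM; field.
by rewrite -natrD -natrM natr1 pnatr_eq0.
Qed.

(** Coefficient of degree j + k - m > j in the differential equation, whose
    right-hand side only has degree j. *)
Lemma expansion_poly_coef_rec (R : realType) (j k m : nat) (r : R) :
  (m < k)%N ->
  m.+1%:R * (expansion_poly j k r)`_(j + k - m.+1) =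
  (m%:R + 2^-1) * r * (expansion_poly j k r)`_(j + k - m).
Proof.
move=> mk; set P := expansion_poly j k r.
have := congr1 (fun p : {poly R} => p`_(j + k - m)) (expansion_poly_ode j k r).
rewrite -/P /=.
have -> : (r ^+ k.+1 *: (r%:P - 'X) ^+ j)`_(j + k - m) = 0.
  rewrite coefZ nth_default ?mulr0 //.
  have -> : r%:P - 'X = - ('X - r%:P) :> {poly R} by rewrite opprB.
  rewrite exprNn -signr_odd mulr_sign; case: ifP => _;
    rewrite ?size_polyN size_exp_XsubC; lia.
have -> : (j + k - m = (j + k - m.+1).+1)%N by lia.
rewrite coefD !coefZ mulrBl coefB coefCM coefXM /= !(coefB, coefZ, coefXM) /=.
rewrite !coef_deriv.
set L := (j + k - m.+1)%N.
have -> : (j + k)%:R = L%:R + m%:R + 1 :> R.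
  by rewrite -natrD natr1 /L; congr _%:R; lia.
have -> : (if L == 0%N then 0 else P`_L.-1.+1 *+ L.-1.+1) = P`_L *+ L.
  by case: (L) => [|L'] //=; rewrite mulr0n.
rewrite -[P`_L *+ L]mulr_natr -[P`_L.+1 *+ L.+1]mulr_natr.
rewrite -(natr1 L) -(natr1 m) => H.
lra.
Qed.

Lemma coef_expansion_poly (R : realType) (j k m : nat) (r : R) :
  (m <= k)%N ->
  (expansion_poly j k r)`_(j + k - m) =
  isqrt_coef R m * r ^+ m * (expansion_poly j k r)`_(j + k).
Proof.
elim: m => [|m IHm] mk; first by rewrite subn0 isqrt_coef0 mulr1 mul1r.
apply: (mulfI (x := m.+1%:R)); first by rewrite pnatr_eq0.
rewrite expansion_poly_coef_rec // IHm 1?ltnW // -mulrA [RHS]mulrA.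
by rewrite [in RHS]mulrA isqrt_coefS exprS; ring.
Qed.

(** The right-hand side does not involve r: this is the source of the
    constancy in rho. *)
Lemma lead_expansion_poly (R : realType) (j k : nat) (r : R) :
  (expansion_poly j k r)`_(j + k) =
  \sum_(i < k.+1) 'C(k, i)%:R / (2 * (j + i) + 1)%:R * (-1) ^+ (j + i).
Proof.
rewrite coef_sum; apply: eq_bigr => i _; rewrite coefZ; congr (_ * _).
have -> : (j + k = (j + i) + (k - i))%N by have := ltn_ord i; lia.
rewrite coefXnM ltnNge leq_addl /= addnK.
have -> : (r%:P - 'X) ^+ (j + i) = ((-1) ^+ (j + i))%:P * ('X - r%:P) ^+ (j + i).
  by rewrite -(opprB 'X) [LHS]exprNn polyC_exp polyCN.
rewrite coefCM.
have /monicP : ('X - r%:P) ^+ (j + i) \is monic.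
  by rewrite monic_exp ?monicXsubC.
by rewrite /lead_coef size_exp_XsubC /= => ->; rewrite mulr1.
Qed.

(** * The Gamma function at integers and half-integers *)

Definition Gamma_integrand (R : realType) (x t : R) : R := t `^ (x - 1) * expR (- t).

Lemma Gamma_integrand_ge0 (R : realType) (x t : R) : 0 <= Gamma_integrand x t.
Proof. by rewrite mulr_ge0 ?powR_ge0 ?expR_ge0. Qed.

Lemma measurable_Gamma_integrand (R : realType) (x : R) :
  measurable_fun setT (Gamma_integrand x).
Proof.
apply: measurable_funM; first exact: measurable_powR.
by apply: measurableT_comp => //; exact: measurableT_comp.
Qed.

Lemma itv0y_bigcup (R : realType) (c : R) : 2 <= c ->
  `]0, +oo[%classic = \bigcup_n `[c ^- n, c ^+ n]%classic.
Proof.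
move=> c2; have c0 : 0 < c by lra.
have c1 : 1 <= c by lra.
apply/seteqP; split=> [t /=|t [n _] /=]; rewrite !in_itv /=; last first.
  move=> /andP[+ _]; rewrite andbT; apply: lt_le_trans.
  by rewrite invr_gt0 exprn_gt0.
rewrite andbT => t0.
have big (u : R) : exists n, u <= c ^+ n.
  exists (Num.bound u); apply: le_trans (ltW (upper_nthrootP (leqnn _))) _.
  by rewrite lerXn2r ?nnegrE ?(ltW c0).
have [n1 hn1] := big t; have [n2 hn2] := big t^-1.
exists (maxn n1 n2) => //=; rewrite in_itv /=; apply/andP; split.
  rewrite -[leRHS]invrK lef_pV2 ?posrE ?exprn_gt0 ?invr_gt0 //.
  by rewrite (le_trans hn2) // ler_weXn2l // leq_maxr.
by rewrite (le_trans hn1) // ler_weXn2l // leq_maxl.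
Qed.

(** The open half-line is exhausted by the compact intervals [c^-n, c^n], on
    which the integrands below are continuous. The base c is a parameter because
    the substitution t = z ^ 2 maps the exhaustion of base 2 to that of
    base 4. *)
Lemma cvg_integral_exhaust (R : realType) (c : R) (f : R -> R) :
  2 <= c -> measurable_fun setT f -> (forall t, 0 <= f t) ->
  (\int[@lebesgue_measure R]_(t in `[(c ^- n)%R, (c ^+ n)%R]) (f t)%:E
     @[n --> \oo] -->
   \int[@lebesgue_measure R]_(t in `]0%R, +oo[) (f t)%:E)%E.
Proof.
move=> c2 mf f0; have c0 : 0 < c by lra.
have c1 : 1 <= c by lra.
rewrite (itv0y_bigcup c2).
apply: ge0_nondecreasing_set_cvg_integral.
- apply/nondecreasing_seqP => n; rewrite subsetEset; apply: subset_itv.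
    by rewrite bnd_simp lef_pV2 ?posrE ?exprn_gt0 // ler_weXn2l.
  by rewrite bnd_simp ler_weXn2l.
- by move=> n; exact: measurable_itv.
- by move=> n; apply/measurable_EFinP; exact: measurable_funTS.
- by move=> n t _; rewrite lee_fin.
Qed.

Lemma continuous_powR_gt0 (R : realType) (y t : R) : 0 < t ->
  {for t, continuous (fun u : R => u `^ y)}.
Proof.
move=> t0; apply/differentiable_continuous/derivable1_diffP.
by apply: derivable_powR; rewrite in_itv /= andbT.
Qed.

Lemma is_derive_expRN (R : realType) (t : R) :
  is_derive t 1 (fun u : R => expR (- u)) (- expR (- t)).
Proof.
have h : is_derive t (1 : R) (-%R : R -> R) (-1) by exact: is_deriveNid.
have := is_derive1_comp (is_derive_expR (- t)) h.
by rewrite mulrN1.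
Qed.

Lemma continuous_expRN (R : realType) : continuous (fun u : R => expR (- u)).
Proof.
move=> t; apply/differentiable_continuous/derivable1_diffP.
by have [] := is_derive_expRN t.
Qed.

Lemma continuous_Gamma_integrand (R : realType) (x a b : R) : 0 < a ->
  {within `[a, b], continuous (Gamma_integrand x)}.
Proof.
move=> a0; apply: continuous_in_subspaceT => t /set_mem /=.
rewrite in_itv /= => /andP[at_ _].
apply: cvgM; first exact/continuous_powR_gt0/(lt_le_trans a0).
exact: continuous_expRN.
Qed.

Lemma Gamma_integrand_by_parts (R : realType) (x a b : R) : 0 < a -> a < b ->
  \int[@lebesgue_measure R]_(t in `[a, b]) Gamma_integrand (x + 1) t =
  (a `^ x * expR (- a) - b `^ x * expR (- b)) +
  x * \int[@lebesgue_measure R]_(t in `[a, b]) Gamma_integrand x t.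
Proof.
move=> a0 ab.
pose F (t : R) := t `^ x; pose f (t : R) := x * t `^ (x - 1).
pose G (t : R) := - expR (- t); pose g (t : R) := expR (- t).
have pos (t : R) : t \in `[a, b] -> 0 < t.
  by rewrite in_itv /= => /andP[+ _]; exact: lt_le_trans.
have dF (t : R) : 0 < t -> is_derive t (1:R) F (f t).
  by move=> t0; exact: is_derive1_powR.
have dG (t : R) : is_derive t (1:R) G (g t).
  by have := is_deriveN (is_derive_expRN t); rewrite opprK.
have LR (H h : R -> R) : (forall t : R, 0 < t -> is_derive t (1:R) H (h t)) ->
    derivable_oo_LRcontinuous H a b /\ {in `]a, b[, (H^`())%classic =1 h}.
  move=> dH; have cH (t : R) : 0 < t -> {for t, continuous H}.
    move=> t0; apply/differentiable_continuous/derivable1_diffP.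
    by have [] := dH t t0.
  split.
    split.
    - move=> t; rewrite in_itv /= => /andP[at_ _].
      by have [] := dH t (lt_trans a0 at_).
    - by apply: cvg_at_right_filter; exact: cH.
    - by apply: cvg_at_left_filter; apply: cH; exact: lt_trans ab.
  move=> t; rewrite in_itv /= => /andP[at_ _].
  by rewrite derive1E; have [_ ->] := dH t (lt_trans a0 at_).
have [F1 F2] := LR F f dF.
have [G1 G2] := LR G g (fun (t : R) _ => dG t).
have cg : {within `[a, b], continuous g}.
  by apply: continuous_subspaceT => t; exact: continuous_expRN.
have cf : {within `[a, b], continuous f}.
  apply: continuous_in_subspaceT => t /set_mem /= tab.
  by apply: cvgM; [exact: cvg_cst|exact/continuous_powR_gt0/pos].
have -> : \int[@lebesgue_measure R]_(t in `[a, b]) Gamma_integrand (x + 1) t =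
    \int[@lebesgue_measure R]_(t in `[a, b]) (F t * g t).
  by apply: eq_Rintegral => t _; rewrite /Gamma_integrand addrK.
rewrite (Rintegration_by_parts ab cf F1 F2 cg G1 G2).
have -> : \int[@lebesgue_measure R]_(t in `[a, b]) (f t * G t) =
    - x * \int[@lebesgue_measure R]_(t in `[a, b]) Gamma_integrand x t.
  rewrite -RintegralZl //; last first.
    apply: continuous_compact_integrable; first exact: segment_compact.
    exact: continuous_Gamma_integrand.
  by apply: eq_Rintegral => t _; rewrite /f /G /Gamma_integrand mulrN mulNr mulrA.
rewrite /F /G; ring.
Qed.

(** The Gamma integral as an extended real, so that monotone convergence applies
    before its finiteness is known. *)
Definition eGamma (R : realType) (x : R) : \bar R :=
  (\int[@lebesgue_measure R]_(t in `]0%R, +oo[) (Gamma_integrand x t)%:E)%E.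

(** The boundary terms of the integration by parts on [2^-n, 2^n]. Both are
    dominated by geometric sequences: at 0 by (2 ^ -x) ^ n, and at infinity, since
    exp y >= y ^ (K+1) / (K+1)! with K + 1 > x, by a multiple of
    (2 ^ (x - K - 1)) ^ n. *)
Lemma Gamma_boundary_cvg0 (R : realType) (x : R) : 0 < x ->
  ((2 : R) ^- n) `^ x * expR (- 2 ^- n) - (2 ^+ n) `^ x * expR (- 2 ^+ n)
    @[n --> \oo] --> (0 : R).
Proof.
move=> x0.
have pw (n : nat) (y : R) : ((2 : R) ^+ n) `^ y = ((2 : R) `^ y) ^+ n.
  by rewrite -powR_mulrn // -powRrM mulrC powRrM powR_mulrn ?powR_ge0.
have geo (y : R) : y < 0 -> ((2 : R) `^ y) ^+ n @[n --> \oo] --> (0 : R).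
  move=> y0; apply: cvg_expr; rewrite ger0_norm ?powR_ge0 //.
  by rewrite /powR pnatr_eq0 /= expR_lt1 nmulr_rlt0 // ln_gt0 // ltr1n.
rewrite -[X in _ --> X](subrr 0); apply: cvgB.
  apply: (@squeeze_cvgr _ _ _ _ (cst 0) (fun n => ((2 : R) `^ (- x)) ^+ n)).
  - near=> n; rewrite /= mulr_ge0 ?powR_ge0 ?expR_ge0 //=.
    rewrite -powR_invn // -powRrM (_ : - n%:R * x = - x * n%:R); last by ring.
    rewrite powRrM powR_invn // powR_mulrn ?powR_ge0 // ler_piMr ?exprn_ge0 ?powR_ge0 //.
  - exact: cvg_cst.
  - by apply: geo; rewrite oppr_lt0.
pose K := Num.bound x.
have xK : x < K.+1%:R.
  by rewrite (lt_trans (archi_boundP (ltW x0))) // ltr_nat.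
apply: (@squeeze_cvgr _ _ _ _ (cst 0)
  (fun n => K.+1`!%:R * ((2 : R) `^ (x - K.+1%:R)) ^+ n)).
- near=> n; rewrite /= mulr_ge0 ?powR_ge0 ?expR_ge0 //=.
  rewrite -pw powRB; last first.
    by apply/implyP => _; rewrite gt_eqF ?exprn_gt0.
  rewrite powR_mulrn ?exprn_ge0 // mulrCA ler_wpM2l ?powR_ge0 //.
  rewrite ler_pdivlMr ?exprn_gt0 // expRN mulrC ler_pdivrMr ?expR_gt0 // mulrC.
  rewrite -ler_pdivrMr ?ltr0n ?fact_gt0 //.
  apply: le_trans (@expR_ge1Dxn _ (2 ^+ n) K _); last exact: exprn_ge0.
  by rewrite lerDr.
- exact: cvg_cst.
- rewrite -[X in _ --> X](mulr0 K.+1`!%:R); apply: cvgMr.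
  by apply: geo; rewrite subr_lt0.
Unshelve. all: by end_near. Qed.

(** Functional equation: integrate by parts on [2^-n, 2^n] and let n tend to
    infinity. *)
Lemma eGamma_succ (R : realType) (x g : R) : 0 < x ->
  eGamma x = g%:E -> eGamma (x + 1) = (x * g)%:E.
Proof.
move=> x0 gx.
have I (y : R) (n : nat) :
    (\int[@lebesgue_measure R]_(t in `[(2 ^- n)%R, (2 ^+ n)%R]) (Gamma_integrand y t)%:E =
    (\int[@lebesgue_measure R]_(t in `[(2 ^- n)%R, (2 ^+ n)%R]) Gamma_integrand y t)%R%:E)%E.
  rewrite /Rintegral fineK //; apply: integrable_fin_num => //.
  apply: continuous_compact_integrable; first exact: segment_compact.
  by apply: continuous_Gamma_integrand; rewrite invr_gt0 exprn_gt0.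
have cv (y : R) : ((\int[@lebesgue_measure R]_(t in `[(2 ^- n)%R, (2 ^+ n)%R])
    Gamma_integrand y t)%R%:E)%E @[n --> \oo] --> eGamma y.
  apply: cvg_trans (cvg_integral_exhaust (lexx (2 : R)) (measurable_Gamma_integrand y)
    (Gamma_integrand_ge0 y)).
  by apply: near_eq_cvg; apply: nearW => n; exact: I.
have := cv x; rewrite gx => /fine_cvgP[_ /= cx].
apply: cvg_unique (cv (x + 1)) _ => //.
apply: cvg_EFin; first exact: nearW.
rewrite -[x * g]add0r.
have parts (y : R) : 1 < y -> y^-1 `^ x * expR (- y^-1) - y `^ x * expR (- y)
      + x * \int[@lebesgue_measure R]_(t in `[y^-1, y]) Gamma_integrand x t =
    \int[@lebesgue_measure R]_(t in `[y^-1, y]) Gamma_integrand (x + 1) t.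
  move=> y1; have y0 : 0 < y by exact: lt_trans y1.
  have yV : y^-1 < y by apply: (lt_trans _ y1); rewrite invf_lt1.
  have yV0 : 0 < y^-1 by rewrite invr_gt0.
  exact: esym (Gamma_integrand_by_parts x yV0 yV).
have H : (((2 : R) ^- n) `^ x * expR (- 2 ^- n) - (2 ^+ n) `^ x * expR (- 2 ^+ n))
    + x * \int[@lebesgue_measure R]_(t in `[2 ^- n, 2 ^+ n]) Gamma_integrand x t
    @[n --> \oo] --> 0 + x * g.
  apply: cvgD; first exact: Gamma_boundary_cvg0.
  by apply: cvgM; [exact: cvg_cst|exact: cx].
apply: cvg_trans H; apply: near_eq_cvg; near=> n => /=.
have n0 : (0 < n)%N by near: n; exact: nbhs_infty_gt.
apply: parts; rewrite exprn_egt1 ?ltr1n // -lt0n //.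
Unshelve. all: by end_near. Qed.

Lemma eGamma1 (R : realType) : eGamma (1 : R) = 1%E.
Proof.
have -> : eGamma (1 : R) =
    (\int[@lebesgue_measure R]_(t in `[0%R, +oo[) (expR (- t))%:E)%E.
  rewrite /eGamma -integral_itv_obnd_cbnd; last first.
    apply/measurable_EFinP/measurable_funTS.
    by apply: continuous_measurable_fun; exact: continuous_expRN.
  by apply: eq_integral => t _; rewrite /Gamma_integrand subrr powRr0 mul1r.
have dE (t : R) : is_derive t (1 : R) (fun u : R => - expR (- u)) (expR (- t)).
  by have := is_deriveN (is_derive_expRN t); rewrite opprK.
rewrite (@ge0_continuous_FTC2y _ _ (fun u : R => - expR (- u)) 0 0).
- by rewrite oppr0 expR0 sub0e EFinN oppeK.
- by move=> t _; exact: expR_ge0.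
- by apply: continuous_subspaceT => t; exact: continuous_expRN.
- by rewrite -[X in _ --> X]oppr0; apply: cvgN; exact: cvgr_expR.
- by move=> t _; have [] := dE t.
- by apply: cvg_at_right_filter; apply: cvgN; exact: continuous_expRN.
- by move=> t _; rewrite derive1E; have [_ ->] := dE t.
Qed.

(** The substitution t = z ^ 2 reduces the integral to the Gaussian one. It is
    made on compact intervals away from 0, where t^(-1/2) is continuous. *)
Lemma eGamma_half (R : realType) : eGamma (2^-1 : R) = (Num.sqrt pi)%:E.
Proof.
pose h (z : R) := 2 * gauss_fun z.
have hI : ((\int[@lebesgue_measure R]_(z in `]0%R, +oo[) (h z)%:E) =
    (Num.sqrt pi)%:E)%E.
  rewrite integral_itv_obnd_cbnd; last first.
    apply/measurable_EFinP/measurable_funTS/measurable_funM => //.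
    exact: measurable_gauss_fun.
  under eq_integral do rewrite /h EFinM.
  rewrite ge0_integralZl //=; last 2 first.
  - by apply/measurable_EFinP/measurable_funTS; exact: measurable_gauss_fun.
  - by move=> z _; rewrite lee_fin gauss_fun_ge0.
  by rewrite integral0y_gauss -EFinM mulrC divfK.
rewrite -hI.
have le24 : 2 <= (2 : R) ^+ 2 by rewrite expr2; lra.
apply: (cvg_unique _
  (cvg_integral_exhaust le24 (measurable_Gamma_integrand 2^-1) (Gamma_integrand_ge0 2^-1))) => //.
have mh : measurable_fun setT h.
  by apply: measurable_funM => //; exact: measurable_gauss_fun.
have h0 (z : R) : 0 <= h z by rewrite mulr_ge0 ?gauss_fun_ge0.
apply: cvg_trans (cvg_integral_exhaust (lexx (2 : R)) mh h0).
apply: near_eq_cvg; apply: nearW => n /=.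
have a0 : 0 < (2 : R) ^- n by rewrite invr_gt0 exprn_gt0.
have ab : (2 : R) ^- n <= 2 ^+ n.
  by rewrite (@le_trans _ _ 1) ?invf_le1 ?exprn_gt0 ?exprn_ege1 ?ler1n.
have -> : ((2 : R) ^+ 2) ^- n = (2 ^- n) ^+ 2.
  by rewrite exprVn -!exprM mulnC.
have -> : ((2 : R) ^+ 2) ^+ n = (2 ^+ n) ^+ 2 by rewrite -!exprM mulnC.
move: ((2 : R) ^- n) a0 ab => a a0; move: ((2 : R) ^+ n) => b ab.
pose F (z : R) := z ^+ 2.
have dF : (F^`())%classic = (fun z : R => 2 * z).
  by apply/funext => z; rewrite /F exp_derive1 expr1.
have cF : continuous F by exact: exprn_continuous.
have c2 : continuous (fun z : R => 2 * z).
  by move=> z; apply: cvgM; [exact: cvg_cst|exact: cvg_id].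
rewrite -/(F a) -/(F b).
rewrite (integration_by_substitution_increasing (F := F) ab).
- apply: eq_integral => z; rewrite inE /= in_itv /= => /andP[az _].
  have z0 : 0 < z by exact: lt_le_trans az.
  rewrite !fctE dF /h /Gamma_integrand /gauss_fun /F.
  have -> : (z ^+ 2) `^ (2^-1 - 1) = z^-1.
    rewrite (_ : 2^-1 - 1 = - 2^-1); last by field.
    by rewrite powRN powR12_sqrt ?sqr_ge0 // sqrtr_sqr gtr0_norm.
  by congr EFin; field; rewrite gt_eqF.
- move=> y z; rewrite !in_itv /= => /andP[ay _] /andP[az _] yz.
  by rewrite /F ltr_pXn2r ?nnegrE ?(le_trans (ltW a0)).
- by rewrite dF => z _; exact: c2.
- by rewrite dF; apply/cvg_ex; exists (2 * a); apply: cvg_at_right_filter; exact: (c2 a).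
- by rewrite dF; apply/cvg_ex; exists (2 * b); apply: cvg_at_left_filter; exact: (c2 b).
- split.
  + by move=> z _; exact: exprn_derivable.
  + by apply: cvg_at_right_filter; exact: cF.
  + by apply: cvg_at_left_filter; exact: cF.
- by apply: continuous_Gamma_integrand; rewrite /F exprn_gt0.
Qed.

Lemma Gamma_nat (R : realType) (m : nat) : Gamma (m%:R + 1 : R) = m`!%:R.
Proof.
suff : eGamma (m%:R + 1 : R) = (m`!%:R)%:E by rewrite /eGamma /Gamma /Rintegral => ->.
elim: m => [|m IHm]; first by rewrite add0r eGamma1.
rewrite -[m.+1%:R]natr1 (eGamma_succ _ IHm) ?factS ?natrM ?natr1 ?ltr0n //.
Qed.

Lemma Gamma_half (R : realType) (m : nat) :
  Gamma (m%:R + 2^-1 : R) = poch 2^-1 m * Num.sqrt pi.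
Proof.
suff : eGamma (m%:R + 2^-1 : R) = (poch 2^-1 m * Num.sqrt pi)%:E.
  by rewrite /eGamma /Gamma /Rintegral => ->.
elim: m => [|m IHm]; first by rewrite add0r eGamma_half /poch big_ord0 mul1r.
have m0 : 0 < m%:R + 2^-1 :> R by rewrite ltr_wpDl.
rewrite -[m.+1%:R]natr1 addrAC (eGamma_succ m0 IHm) pochS; congr EFin.
ring.
Qed.

(** * The polynomials mu_m and the conclusion *)

Lemma limn_terminating (R : realType) (u : nat -> R) (m : nat) :
  (forall n, (m <= n)%N -> u n = 0) -> limn (series u) = \sum_(i < m) u i.
Proof.
move=> u0; apply/cvg_lim => //.
apply: cvg_near_cst; near=> n.
rewrite /series /= -(big_mkord xpredT u).
have mn : (m <= n)%N by near: n; exact: nbhs_infty_ge.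
rewrite (big_cat_nat (n := m)) //= [X in _ + X]big_nat_cond [X in _ + X]big1 ?addr0 //.
by move=> i /andP[/andP[/u0]].
Unshelve. all: by end_near. Qed.

(** Reading a Pochhammer product backwards; it applies to both parameters
    1 - m and 1/2 - m of the hypergeometric function, with c = 1 (and m - 1 for m)
    and with c = 1/2. *)
Lemma poch_reflect (R : realType) (c : R) (n m : nat) : (n <= m)%N ->
  poch (1 - m%:R - c) n * poch c (m - n) = (-1) ^+ n * poch c m.
Proof.
elim: n => [|n IHn] nm; first by rewrite subn0 /poch big_ord0 expr0.
rewrite pochS exprS -mulrA -mulrA -IHn ?(ltnW nm) //.
have -> : (m - n = (m - n.+1).+1)%N by rewrite subnSK.
rewrite pochS natrB // -natr1; ring.
Qed.

(** The factor (1 - m)_i vanishes for i >= m, so that the series is a finite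
    sum, and Gamma (m + 1/2) / (sqrt pi m!) is a_m. *)
Lemma muE (R : realType) (m : nat) (rho : R) : (0 < m)%N ->
  mu m rho = 2 * \sum_(i < m) isqrt_coef R i * isqrt_coef R (m - i) * (m - i)%:R / m%:R *
     (rho ^+ 2) ^+ i.
Proof.
move=> m0.
have p0 (n : nat) : 0 < poch (2^-1 : R) n.
  by apply: prodr_gt0 => i _; rewrite ltr_wpDr.
have p1 (n : nat) : poch (1 : R) n = n`!%:R.
  elim: n => [|n IHn]; first by rewrite /poch big_ord0.
  by rewrite pochS IHn factS nat1r natrM mulrC.
have f0 (n : nat) : n`!%:R != 0 :> R by rewrite pnatr_eq0 -lt0n fact_gt0.
have pi0 : Num.sqrt pi != 0 :> R by rewrite gt_eqF // sqrtr_gt0 pi_gt0.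
rewrite /mu Gamma_half Gamma_nat /hyp2F1 (limn_terminating (m := m)); last first.
  move=> n mn; have -> : poch (1 - m%:R) n = 0 :> R.
    have im : (m.-1 < n)%N by rewrite prednK.
    rewrite /poch (bigD1 (Ordinal im)) //= -[m in 1 - m%:R](prednK m0) -natr1.
    have -> : 1 - (m.-1%:R + 1) + m.-1%:R = 0 :> R by ring.
    by rewrite mul0r.
  by rewrite !mul0r.
rewrite mulr_sumr mulr_sumr; apply: eq_bigr => i _.
have im : (i < m)%N by [].
have e1 := poch_reflect (2^-1 : R) (ltnW im).
have im1 : (i <= m.-1)%N by rewrite -ltnS prednK.
have e2 := poch_reflect (1 : R) im1.
move: e1 e2.
have -> : 1 - m%:R - 2^-1 = 2^-1 - m%:R :> R by field.
have -> : 1 - m.-1%:R - 1 = 1 - m%:R :> R by rewrite -[in RHS](prednK m0) -natr1; ring.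
rewrite !p1 /isqrt_coef => e1 e2.
have emi : (m - i)`!%:R = (m - i)%:R * (m.-1 - i)`!%:R :> R.
  have -> : (m - i = (m.-1 - i).+1)%N by lia.
  by rewrite factS natrM.
have em : m`!%:R = m%:R * m.-1`!%:R :> R.
  by rewrite -[in LHS](prednK m0) factS natrM prednK.
have q1 : poch (2^-1 - m%:R) i = (-1) ^+ i * poch 2^-1 m / poch 2^-1 (m - i) :> R.
  by rewrite -e1 mulfK // gt_eqF.
have q2 : poch (1 - m%:R) i = (-1) ^+ i * m.-1`!%:R / (m.-1 - i)`!%:R :> R.
  by rewrite -e2 mulfK.
rewrite q1 q2 emi em.
have s0 : (-1) ^+ i != 0 :> R by rewrite signr_eq0.
have mi0 : (m - i)%:R != 0 :> R by rewrite pnatr_eq0 subn_eq0 -ltnNge.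
have mm0 : m%:R != 0 :> R by rewrite pnatr_eq0 -lt0n.
move: (f0 i) (f0 m.-1) (f0 (m.-1 - i)%N) => g1 g2 g3.
move: (lt0r_neq0 (p0 m)) (lt0r_neq0 (p0 i)) (lt0r_neq0 (p0 (m - i)%N)) => g4 g5 g6.
move: ((rho ^+ 2) ^+ i) ((-1) ^+ i) s0 (m%:R) mm0 => t sg s0 mR mm0.
by field; rewrite mm0 g3 mi0 g1 g6 g4 s0 g2.
Qed.

Theorem theorem1 (R : realType) (j k : nat) (hj : (0 < j)%N) (hk : (0 < k)%N)
    (B : nat -> R -> R) (hB : is_expansion j k B)
    (N : nat) (hN : (0 < N)%N) (hjN : (j <= N <= k + j)%N) :
  exists C : R, forall rho : R, 0 < rho ->
    B N rho + (1 - rho ^+ 2) / 2 *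
      \sum_(1 <= m < (j + k - N).+1) mu m rho * B (N + m)%N rho = C.
Proof.
set M := (j + k - N)%N.
have [MN Mk] : N = (j + k - M)%N /\ (M <= k)%N by rewrite /M; lia.
(* The sum is B_(j+k), by [lead_expansion_poly]. *)
exists (isqrt_coef R M * \sum_(i < k.+1)
  'C(k, i)%:R / (2 * (j + i) + 1)%:R * (-1) ^+ (j + i)) => rho rho0.
rewrite -(lead_expansion_poly j k (rho ^+ 2)).
set T := (expansion_poly _ _ _)`_(j + k).
have Bcoef (m : nat) : (m <= M)%N ->
    B (N + m)%N rho = isqrt_coef R (M - m) * (rho ^+ 2) ^+ (M - m) * T.
  move=> mM; rewrite (B_eq_coef hB rho0); last by rewrite MN; lia.
  by rewrite -coef_expansion_poly; [congr (_`_ _); lia|lia].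
rewrite -[in B N rho](addn0 N) Bcoef // subn0.
set r := rho ^+ 2 in T Bcoef *.
have -> : \sum_(1 <= m < M.+1) mu m rho * B (N + m)%N rho =
    2 * T * \sum_(1 <= m < M.+1)
     (\sum_(i < m) isqrt_coef R i * isqrt_coef R (m - i) * (m - i)%:R / m%:R * r ^+ i) *
     (isqrt_coef R (M - m) * r ^+ (M - m)).
  rewrite mulr_sumr; apply: eq_big_nat => m /andP[m0 mM].
  by rewrite muE // Bcoef //; ring.
set S := \sum_(1 <= m < _) _.
have -> : (1 - r) / 2 * (2 * T * S) = T * ((1 - r) * S) by field.
rewrite mu_sum_collapse; ring.
Qed.
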